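(* Fix a self-adjoint boundary condition. Then each continuous eigenvalue branch $\Lambda$ over $\Omega_N^{\mathbb{R},+}$ is decreasing in every $(1/f_n)$-direction with $0\le n\le N-1$, independent of $f_N$, and increasing in every $q_n$-direction; while the positive parts of $\Lambda$ are decreasing in every $w_n$-direction, and the negative parts of $\Lambda$ are increasing in every $w_n$-direction. (Monotonicity is not necessarily strict.)
   Context: $N\ge2$ is an integer, $\Delta y_n=y_{n+1}-y_n$, $\nabla y_n=y_n-y_{n-1}$. A discrete Sturm-Liouville equation $-\nabla(f_n\Delta y_n)+q_ny_n=\lambda w_ny_n$, $1\le n\le N$, is identified with $(1/f,q,w)=(1/f_0,\dots,1/f_N,q_1,\dots,q_N,w_1,\dots,w_N)$; $\Omega_N^{\mathbb{R},+}$ is the open subset of $\mathbb{R}^{3N+1}$ of such real triples with all $f_n\ne0$ and all $w_n>0$. A boundary condition is $A\begin{pmatrix}y_0\\ f_0\Delta y_0\end{pmatrix}+B\begin{pmatrix}y_N\\ f_N\Delta y_N\end{pmatrix}=0$ with $A,B$ complex $2\times2$ matrices, $\mathrm{rank}(A,B)=2$; it is self-adjoint if $AEA^*=BEB^*$, $E=\begin{pmatrix}0&1\\-1&0\end{pmatrix}$. A number $\lambda$ is an eigenvalue of the problem if there is a nonzero complex sequence $y=\{y_n\}_{n=0}^{N+1}$ satisfying both the equation and the boundary condition; for self-adjoint problems (equation in $\Omega_N^{\mathbb{R},+}$, self-adjoint boundary condition) eigenvalues are real, with multiplicity (dimension of the solution space, which equals the order as a zero of the characteristic polynomial) $1$ or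 $2$. A continuous eigenvalue branch over $\Omega_N^{\mathbb{R},+}$ (boundary condition fixed) is a continuous function $\Lambda$ from a connected open subset of $\Omega_N^{\mathbb{R},+}$ to $\mathbb{R}$ whose value at each equation $\boldsymbol{\sigma}$ in the domain is an eigenvalue for $\boldsymbol{\sigma}$, and which near each $\boldsymbol{\omega}$ in its domain coincides with one of the following: if $\Lambda(\boldsymbol{\omega})$ is simple, the locally unique continuous function through $\Lambda(\boldsymbol{\omega})$ whose values are simple eigenvalues; if $\Lambda(\boldsymbol{\omega})$ has multiplicity $2$, one of the two functions $\Lambda_1\le\Lambda_2$ giving the exactly two eigenvalues (counting multiplicity) near $\Lambda(\boldsymbol{\omega})$ of equations near $\boldsymbol{\omega}$. Monotonicity in a coordinate direction ($1/f_n$, $q_n$ or $w_n$) refers to the restriction of $\Lambda$ to intervals of that coordinate, the other coordinates being fixed, along which the equation lies in the domain of $\Lambda$. The positive (negative) parts of $\Lambda$ are its restrictions to where $\Lambda>0$ ($\Lambda<0$). *)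

(* Defs.v *)
From HB Require Import structures.
From mathcomp Require Import all_boot all_order all_algebra.
From mathcomp Require Import complex.
From mathcomp Require Import all_classical all_reals all_analysis.

Set Implicit Arguments.
Unset Strict Implicit.
Unset Printing Implicit Defensive.

Import Order.TTheory GRing.Theory Num.Theory.
Import numFieldNormedType.Exports.

Local Open Scope classical_set_scope.
Local Open Scope ring_scope.
Local Open Scope complex_scope.

Definition Delta (V : zmodType) (y : nat -> V) (n : nat) : V := y n.+1 - y n.
Definition Nabla (V : zmodType) (y : nat -> V) (n : nat) : V := y n - y n.-1.

(* A point of R^(3N+1), read as ((1/f, q), w).  The first vector stores 1/f_n,
   not f_n, at position n (0 <= n <= N); the entries q_n and w_n
   (1 <= n <= N) are stored at position n - 1. *)
Notation sl_eqn R N := ('rV[R]_N.+1 * 'rV[R]_N * 'rV[R]_N)%type.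

Definition coef_f (R : realType) (N : nat) (s : sl_eqn R N) (n : nat) : R :=
  (s.1.1 0 (inord n))^-1.
Definition coef_q (R : realType) (N : nat) (s : sl_eqn R N) (k : 'I_N) : R :=
  s.1.2 0 k.
Definition coef_w (R : realType) (N : nat) (s : sl_eqn R N) (k : 'I_N) : R :=
  s.2 0 k.

Definition Omega (R : realType) (N : nat) : set (sl_eqn R N) :=
  [set s : sl_eqn R N | (forall n, s.1.1 0 n != 0) /\ (forall k, 0 < coef_w s k)].

(* y_n for 0 <= n <= N + 1; the values of inord beyond that range are never
   used below. *)
Definition entry (T : Type) (m : nat) (y : 'rV[T]_m.+1) (n : nat) : T :=
  y 0 (inord n).

(* f_n Delta y_n *)
Definition quasi_diff (R : realType) (N : nat) (s : sl_eqn R N)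
    (y : 'rV[R[i]]_N.+2) (n : nat) : R[i] :=
  (coef_f s n)%:C * Delta (entry y) n.

Definition satisfies_eqn (R : realType) (N : nat) (s : sl_eqn R N)
    (l : R[i]) (y : 'rV[R[i]]_N.+2) : Prop :=
  forall k : 'I_N, let n := k.+1 in
    - Nabla (quasi_diff s y) n + (coef_q s k)%:C * entry y n
    = l * (coef_w s k)%:C * entry y n.

Definition boundary_vector (R : realType) (N : nat) (s : sl_eqn R N)
    (y : 'rV[R[i]]_N.+2) (n : nat) : 'cV[R[i]]_2 :=
  \col_(i < 2) [:: entry y n; quasi_diff s y n]`_i.

Definition satisfies_bc (R : realType) (N : nat) (A B : 'M[R[i]]_2)
    (s : sl_eqn R N) (y : 'rV[R[i]]_N.+2) : Prop :=
  A *m boundary_vector s y 0 + B *m boundary_vector s y N = 0.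

Definition conj_transpose (R : realType) (A : 'M[R[i]]_2) : 'M[R[i]]_2 :=
  map_mx Num.conj A^T.

Definition symplectic_E (R : realType) : 'M[R[i]]_2 :=
  block_mx (0 : 'M[R[i]]_1) 1%:M (- 1%:M) (0 : 'M[R[i]]_1).

Definition self_adjoint_bc (R : realType) (A B : 'M[R[i]]_2) : Prop :=
  \rank (row_mx A B) = 2%N /\
  A *m symplectic_E R *m conj_transpose A
  = B *m symplectic_E R *m conj_transpose B.

Definition sl_solution (R : realType) (N : nat) (A B : 'M[R[i]]_2)
    (s : sl_eqn R N) (l : R[i]) (y : 'rV[R[i]]_N.+2) : Prop :=
  satisfies_eqn s l y /\ satisfies_bc A B s y.

Definition sl_eigenvalue (R : realType) (N : nat) (A B : 'M[R[i]]_2)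
    (s : sl_eqn R N) (l : R[i]) : Prop :=
  exists2 y : 'rV[R[i]]_N.+2, y != 0 & sl_solution A B s l y.

(* Multiplicity 0 means that l is not an eigenvalue. *)
Definition has_multiplicity (R : realType) (N : nat) (A B : 'M[R[i]]_2)
    (s : sl_eqn R N) (l : R[i]) (m : nat) : Prop :=
  exists2 V : {vspace 'rV[R[i]]_N.+2},
    forall y, y \in V <-> sl_solution A B s l y & \dim V = m.

Definition simple_branch_through (R : realType) (N : nat) (A B : 'M[R[i]]_2)
    (o : sl_eqn R N) (l : R) (F : sl_eqn R N -> R) : Prop :=
  F o = l /\
  \forall s \near o,
    {for s, continuous F} /\ has_multiplicity A B s (F s)%:C 1.

Definition follows_simple_branch (R : realType) (N : nat) (A B : 'M[R[i]]_2)
    (L : sl_eqn R N -> R) (o : sl_eqn R N) : Prop :=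
  exists F : sl_eqn R N -> R,
    [/\ simple_branch_through A B o (L o) F,
        forall G, simple_branch_through A B o (L o) G ->
          \forall s \near o, G s = F s
      & \forall s \near o, L s = F s].

(* l1 <= l2 are exactly the two eigenvalues of s, counting multiplicity, at
   distance < e from l; the booleans in the last clause are summed in nat, so a
   coincidence l1 = l2 is an eigenvalue of multiplicity 2. *)
Definition eigenvalue_pair_near (R : realType) (N : nat) (A B : 'M[R[i]]_2)
    (s : sl_eqn R N) (l e l1 l2 : R) : Prop :=
  [/\ l1 <= l2, `|l1 - l| < e, `|l2 - l| < e
    & forall m : R, `|m - l| < e ->
        has_multiplicity A B s m%:C ((m == l1) + (m == l2))%N].

Definition follows_double_branch (R : realType) (N : nat) (A B : 'M[R[i]]_2)
    (L : sl_eqn R N -> R) (o : sl_eqn R N) : Prop :=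
  exists (e : R) (F1 F2 : sl_eqn R N -> R),
    [/\ 0 < e,
        \forall s \near o, eigenvalue_pair_near A B s (L o) e (F1 s) (F2 s)
      & (\forall s \near o, L s = F1 s) \/ (\forall s \near o, L s = F2 s)].

(* A function on D is represented by a total function, whose values outside D
   are irrelevant. *)
Definition continuous_eigenvalue_branch (R : realType) (N : nat)
    (A B : 'M[R[i]]_2) (D : set (sl_eqn R N)) (L : sl_eqn R N -> R) : Prop :=
  [/\ open D /\ connected D, D `<=` @Omega R N, {within D, continuous L},
      forall s, D s -> sl_eigenvalue A B s (L s)%:C
    & forall o, D o ->
        (has_multiplicity A B o (L o)%:C 1 -> follows_simple_branch A B L o) /\
        (has_multiplicity A B o (L o)%:C 2 -> follows_double_branch A B L o)].

Definition set_entry (R : realType) (m : nat) (v : 'rV[R]_m) (i : 'I_m) (t : R)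
    : 'rV[R]_m :=
  \row_j (if j == i then t else v 0 j).

(* The coordinate lines through s, parametrized by the varying coordinate. *)
Definition line_invf (R : realType) (N : nat) (n : 'I_N.+1) (s : sl_eqn R N)
    (t : R) : sl_eqn R N := (set_entry s.1.1 n t, s.1.2, s.2).
Definition line_q (R : realType) (N : nat) (k : 'I_N) (s : sl_eqn R N)
    (t : R) : sl_eqn R N := (s.1.1, set_entry s.1.2 k t, s.2).
Definition line_w (R : realType) (N : nat) (k : 'I_N) (s : sl_eqn R N)
    (t : R) : sl_eqn R N := (s.1.1, s.1.2, set_entry s.2 k t).

Definition decreasing_along (R : realType) (N : nat)
    (line : sl_eqn R N -> R -> sl_eqn R N) (D : set (sl_eqn R N))
    (L : sl_eqn R N -> R) : Prop :=
  forall (s : sl_eqn R N) (I : interval R),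
    (forall t, t \in I -> D (line s t)) ->
    {in I &, forall t1 t2, t1 <= t2 -> L (line s t2) <= L (line s t1)}.

Definition increasing_along (R : realType) (N : nat)
    (line : sl_eqn R N -> R -> sl_eqn R N) (D : set (sl_eqn R N))
    (L : sl_eqn R N -> R) : Prop :=
  forall (s : sl_eqn R N) (I : interval R),
    (forall t, t \in I -> D (line s t)) ->
    {in I &, forall t1 t2, t1 <= t2 -> L (line s t1) <= L (line s t2)}.

Definition constant_along (R : realType) (N : nat)
    (line : sl_eqn R N -> R -> sl_eqn R N) (D : set (sl_eqn R N))
    (L : sl_eqn R N -> R) : Prop :=
  forall (s : sl_eqn R N) (I : interval R),
    (forall t, t \in I -> D (line s t)) ->
    {in I &, forall t1 t2, L (line s t1) = L (line s t2)}.

(* Main.v *)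
Require Import Defs.
From HB Require Import structures.
From mathcomp Require Import all_boot all_order all_algebra.
From mathcomp Require Import complex.
From mathcomp Require Import all_classical all_reals all_analysis.
From mathcomp Require Import ring lra.

Set Implicit Arguments.
Unset Strict Implicit.
Unset Printing Implicit Defensive.

Import Order.TTheory GRing.Theory Num.Theory.
Import numFieldNormedType.Exports.

Local Open Scope classical_set_scope.
Local Open Scope ring_scope.
Local Open Scope complex_scope.

(** The argument is first-order perturbation theory in the spirit of
    Hellmann and Feynman, arranged so that the multiplicity of the eigenvalue
    is never an issue.

    Write u = f Delta y.  With p = 1/f, the problem becomes the linear system
      y_{n+1} - y_n = p_n u_n,   u_n - u_{n-1} = (q_n - l w_n) y_n
    together with the boundary condition on (y_0, u_0, y_N, u_N); the entry
    1/f_N does not appear.  Let (y, u) solve the problem s' at the real number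
    l', and (z, v) the problem s at l.  Summation by parts
    ([lagrange_identity]), whose boundary terms cancel by self-adjointness
    ([self_adjoint_bc_wronskian]), gives, in real parts,
      (l' - l) sum w_n y_n z_n^* = sum ((q'_n - q_n) - l' (w'_n - w_n)) y_n z_n^*
                                 - sum_{n < N} (p'_n - p_n) u_n v_n^*.
    If (z, v) were equal to (y, u), all products would be nonnegative and the
    signs in the theorem could be read off.  They can be taken close: when s'
    is near s and l' near l, the vector (y, u) almost solves the problem s at
    l, so it lies close to an exact solution (z, v) by the linear algebra fact
    [dist_to_kernel].  This picks (z, v) inside the eigenspace as a function of
    (y, u), whence simple and double eigenvalues are handled alike.
    Since sum w_n |y_n|^2 is positive definite on solutions, all products are
    then at least - e times the sum on the left ([near_kernel]), and
      L s' - L s = sum ((q'_n - q_n) - L s' (w'_n - w_n)) a_n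
                 - sum_{n < N} (p'_n - p_n) b_n,   a_n >= - e, b_n >= - e,
    for s' close to s ([hellmann_feynman]).

    Along a coordinate line one term survives at most, so that every difference
    quotient of L has the expected sign up to an arbitrarily small error.  By
    a supremum argument ([nonincreasing_of_slopes_le0]) this suffices for
    monotonicity, and along 1/f_N it makes L both increasing and decreasing. *)

(** * The l1 norm on complex row vectors, and the distance to a kernel *)

Section Norm.
Context (R : realType).
Local Notation C := R[i].
Local Notation normc := (@Normc.normc R).
Local Notation Re := (@complex.Re R).

Lemma normc_ge0 (z : C) : 0 <= normc z.
Proof. by case: z => a b; exact: sqrtr_ge0. Qed.

Lemma normc_real (a : R) : normc a%:C = `|a|.
Proof. by rewrite /= expr0n /= addr0 sqrtr_sqr. Qed.

Lemma Re_le_normc (z : C) : `|Re z| <= normc z.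
Proof.
case: z => a b /=; rewrite -sqrtr_sqr ler_wsqrtr// lerDl sqr_ge0//.
Qed.

Lemma Re_mulJ (z : C) : Re (z * conjc z) = normc z ^+ 2.
Proof.
by case: z => a b /=; rewrite sqr_sqrtr ?addr_ge0 ?sqr_ge0//; ring.
Qed.

Lemma normc_conj (z : C) : normc (conjc z) = normc z.
Proof. by case: z => a b /=; rewrite sqrrN. Qed.

Lemma normcD (z w : C) : normc (z + w) <= normc z + normc w.
Proof. exact: (@le_normcD R z w). Qed.

Definition l1norm n (x : 'rV[C]_n) : R := \sum_j normc (x 0 j).

Lemma l1norm_ge0 n (x : 'rV[C]_n) : 0 <= l1norm x.
Proof. by apply: sumr_ge0 => j _; exact: normc_ge0. Qed.

Lemma normc_le_l1norm n (x : 'rV[C]_n) j : normc (x 0 j) <= l1norm x.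
Proof.
by rewrite /l1norm (bigD1 j)//= lerDl sumr_ge0// => k _; exact: normc_ge0.
Qed.

Lemma l1norm_eq0 n (x : 'rV[C]_n) : l1norm x = 0 -> x = 0.
Proof.
move=> x0; apply/rowP => j; rewrite mxE; apply: Normc.eq0_normc.
by apply/eqP; rewrite eq_le normc_ge0 andbT -x0 normc_le_l1norm.
Qed.

Lemma l1norm_gt0 n (x : 'rV[C]_n) : x != 0 -> 0 < l1norm x.
Proof.
by move=> x0; rewrite lt_neqAle l1norm_ge0 andbT eq_sym;
  apply: contra x0 => /eqP /l1norm_eq0 ->.
Qed.

Lemma l1norm_row_mx n m (x : 'rV[C]_n) (z : 'rV[C]_m) :
  l1norm (row_mx x z) = l1norm x + l1norm z.
Proof.
rewrite /l1norm big_split_ord/=; congr (_ + _); apply: eq_bigr => j _.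
  by rewrite row_mxEl.
by rewrite row_mxEr.
Qed.

Lemma normc_sum (I : Type) (r : seq I) (P : pred I) (F : I -> C) :
  normc (\sum_(i <- r | P i) F i) <= \sum_(i <- r | P i) normc (F i).
Proof.
elim/big_rec2: _ => [|i z w _ le_zw]; first by rewrite Normc.normc0.
by apply: le_trans (normcD _ _) _; rewrite lerD2l.
Qed.

Lemma l1norm_mulmx_bounded n m (P : 'M[C]_(n, m)) :
  exists2 K : R, 0 <= K & forall x, l1norm (x *m P) <= K * l1norm x.
Proof.
exists (\sum_i l1norm (row i P)); first by apply: sumr_ge0 => i _; exact: l1norm_ge0.
move=> x; rewrite {1}/l1norm.
apply: (@le_trans _ _ (\sum_j \sum_i normc (x 0 i) * normc (P i j))).
  apply: ler_sum => j _; rewrite mxE; apply: le_trans (normc_sum _ _ _) _.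
  by apply: ler_sum => i _; rewrite Normc.normcM.
rewrite exchange_big/= mulr_suml; apply: ler_sum => i _.
rewrite -mulr_sumr mulrC; apply: ler_pM; rewrite ?normc_ge0 ?normc_le_l1norm//.
  by apply: sumr_ge0 => j _; exact: normc_ge0.
by apply: ler_sum => j _; rewrite mxE.
Qed.

(** With P a generalized inverse of the matrix of F, subtracting (F x) P from x
    annihilates F x, and the correction is bounded by F x. *)
Lemma dist_to_kernel n m (F : {linear 'rV[C]_n -> 'rV[C]_m}) :
  exists2 K : R, 0 <= K & forall x, exists2 x0, F x0 = 0 &
    l1norm (x - x0) <= K * l1norm (F x).
Proof.
pose M := lin1_mx F.
have [K K0 bound] := l1norm_mulmx_bounded (pinvmx M).
exists K => // x; exists (x - F x *m pinvmx M); last by rewrite subKr.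
rewrite linearB/= -(mul_rV_lin1 F (F x *m _)) -/M.
by rewrite mulmxKpV ?subrr// -(mul_rV_lin1 F x) submxMl.
Qed.

End Norm.

(** * Exact solutions close to approximate ones *)

Section NearKernel.
Context (R : realType) (n m : nat).
Local Notation C := R[i].
Local Notation normc := (@Normc.normc R).
Local Notation Re := (@complex.Re R).

(** The real part of a weighted Hermitian product, positive semidefinite when
    the weights [a] are nonnegative. *)
Definition wdot (a : 'I_n -> R) (x z : 'rV[C]_n) : R :=
  \sum_i a i * Re (x 0 i * conjc (z 0 i)).

Lemma wdot_self a x : wdot a x x = \sum_i a i * normc (x 0 i) ^+ 2.
Proof. by apply: eq_bigr => i _; rewrite Re_mulJ. Qed.

(** The product z w^* is |z|^2 - z (z - w)^*. *)
Lemma Re_mulJ_near (z w : C) : normc z ^+ 2 - normc z * normc (z - w)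
  <= Re (z * conjc w).
Proof.
have -> : z * conjc w = z * conjc z - z * conjc (z - w) by rewrite rmorphB/=; ring.
rewrite raddfB/= Re_mulJ lerD2l lerN2 -(normc_conj (z - w)) -Normc.normcM.
exact: le_trans (ler_norm _) (Re_le_normc _).
Qed.

Variables (F : {linear 'rV[C]_n -> 'rV[C]_m}) (a : 'I_n -> R).
Hypothesis a_ge0 : forall i, 0 <= a i.
Hypothesis definite : forall x, F x = 0 -> (forall i, a i != 0 -> x 0 i = 0) -> x = 0.

(* The form is definite on the kernel of F exactly when F and the rescaling T by
   the weights have no common kernel, that is, when G is injective. *)
Let T (x : 'rV[C]_n) : 'rV[C]_n := \row_i ((a i)%:C * x 0 i).
Let G (x : 'rV[C]_n) : 'rV[C]_(m + n) := row_mx (F x) (T x).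

Let G_linear : linear G.
Proof.
move=> c x z; rewrite /G linearP/= scale_row_mx add_row_mx; congr row_mx.
by apply/rowP => i; rewrite !mxE; ring.
Qed.
HB.instance Definition _ := GRing.isLinear.Build C _ _ _ G G_linear.

(** [dist_to_kernel] applied to the injective map G. *)
Lemma l1norm_le_of_definite : exists2 K : R, 0 < K & forall x,
  l1norm x <= K * (l1norm (F x) + \sum_i a i * normc (x 0 i)).
Proof.
have [K K0 dist] := dist_to_kernel G.
exists (K + 1) => [|x]; first by lra.
have [x0 Gx0 le_x] := dist x.
have x00 : x0 = 0.
  apply: definite => [|i ai].
    by have := congr1 lsubmx Gx0; rewrite /G row_mxKl linear0.
  have /rowP/(_ i) := congr1 rsubmx Gx0; rewrite /G row_mxKr linear0 !mxE.
  move/eqP; rewrite mulf_eq0 => /orP[|/eqP//].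
  by move=> /eqP[] /eqP; rewrite (negPf ai).
move: le_x; rewrite x00 subr0 /G l1norm_row_mx => /le_trans; apply.
have -> : l1norm (T x) = \sum_i a i * normc (x 0 i).
  by apply: eq_bigr => i _; rewrite mxE Normc.normcM normc_real ger0_norm.
apply: ler_wpM2r; last by lra.
by rewrite addr_ge0 ?l1norm_ge0// sumr_ge0// => i _; rewrite mulr_ge0 ?normc_ge0.
Qed.

(** Were x an exact solution, x0 = x would do, with 0 as a lower bound in place
    of - e times the form.  In general x0 is the exact solution provided by
    [dist_to_kernel]; it differs from x by O(h |x|), whereas the form at x is at
    least a multiple of |x|^2, so a small h absorbs the error. *)
Lemma near_kernel (e : R) : 0 < e -> exists2 h : R, 0 < h &
  forall x, x != 0 -> l1norm (F x) <= h * l1norm x ->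
  exists x0, [/\ F x0 = 0, 0 < wdot a x x0 &
    forall j, - (e * wdot a x x0) <= Re (x 0 j * conjc (x0 0 j))].
Proof.
move=> e0.
have [K K0 coercive] := l1norm_le_of_definite.
have [K' K'0 dist] := dist_to_kernel F.
pose s := \sum_i a i.
have s0 : 0 <= s by exact: sumr_ge0.
(* Definiteness bounds |x| by K times the weighted l1 norm, and the latter is
   compared with the form by th r |x_i| <= (th r)^2 + |x_i|^2, r = |x|.  With
   this th, summing the error (th r)^2 over the weights costs at most a third of
   what is gained, and the form at x is at least k r^2. *)
pose th := (4 * K * (s + 1))^-1.
have th0 : 0 < th by rewrite invr_gt0 !mulr_gt0//; lra.
pose k := th / (2 * K).
have k0 : 0 < k by rewrite divr_gt0// mulr_gt0//.
pose h := Num.min (4 * K)^-1 (Num.min (k / 2 / (s * K' + 1)) (e * (k / 2) / (K' + 1))).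
have sK'0 : 0 <= s * K' by exact: mulr_ge0.
have h0 : 0 < h.
  rewrite !lt_min invr_gt0; apply/and3P; split; first by lra.
    by apply: divr_gt0; lra.
  by apply: divr_gt0; [apply: mulr_gt0|]; lra.
have hK : h * K <= 1 / 4.
  have : h <= (4 * K)^-1 by rewrite /h ge_min lexx.
  rewrite invfM => hle; have : h * K <= 4^-1 / K * K by rewrite ler_wpM2r// ltW.
  by rewrite mulfVK ?gt_eqF//; lra.
have hsK' : h * (s * K') <= k / 2.
  have : h <= k / 2 / (s * K' + 1) by rewrite /h !ge_min lexx orbT.
  rewrite ler_pdivlMr; [nra | lra].
have hK' : h * K' <= e * (k / 2).
  have : h <= e * (k / 2) / (K' + 1) by rewrite /h !ge_min lexx !orbT.
  rewrite ler_pdivlMr; [nra | lra].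
exists h => // x xn0 Fx; have r0 := l1norm_gt0 xn0.
have [x0 Fx0 le_d] := dist x.
have le_r i := normc_le_l1norm x i.
have := coercive x; move: (l1norm x) Fx r0 le_r => r Fx r0 le_r coer.
have {le_d} close i : normc (x 0 i - x0 0 i) <= K' * h * r.
  have := normc_le_l1norm (x - x0) i; rewrite !mxE => /le_trans; apply.
  by apply: le_trans le_d _; rewrite -mulrA ler_wpM2l.
have self : k * r ^+ 2 <= wdot a x x.
  set t := \sum_i a i * normc (x 0 i).
  have ht : r * (3 / 4) <= K * t.
    rewrite -/t in coer.
    have : K * l1norm (F x) <= K * (h * r) by rewrite ler_wpM2l// ltW.
    nra.
  have : th * r * t <= th ^+ 2 * r ^+ 2 * s + wdot a x x.
    rewrite wdot_self /t /s !mulr_sumr -big_split/=; apply: ler_sum => i _.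
    have -> : th * r * (a i * normc (x 0 i)) = a i * (th * r * normc (x 0 i)) by ring.
    have -> : th ^+ 2 * r ^+ 2 * a i + a i * normc (x 0 i) ^+ 2
      = a i * (th ^+ 2 * r ^+ 2 + normc (x 0 i) ^+ 2) by ring.
    apply: ler_wpM2l => //; nra.
  have ths : th * s <= (4 * K)^-1.
    rewrite /th invfM -mulrA ler_piMr ?invr_ge0 ?mulr_ge0 ?(ltW K0)//.
    by rewrite mulrC ler_pdivrMr; lra.
  have tK : r * (3 / 4) / K <= t by rewrite ler_pdivrMr// [t * K]mulrC.
  have -> : k = th * (2 * K)^-1 by [].
  move: ths tK; rewrite !invfM => ths tK.
  have Ki : 0 < K^-1 by rewrite invr_gt0.
  have thr : 0 <= th * r by rewrite mulr_ge0// ltW.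
  have thr2 : 0 <= th * r ^+ 2 by rewrite mulr_ge0 ?sqr_ge0// ltW.
  have := ler_wpM2l thr tK; have := ler_wpM2l thr2 ths; nra.
have S_ge : k / 2 * r ^+ 2 <= wdot a x x0.
  have : wdot a x x - s * (r * (K' * h * r)) <= wdot a x x0.
    rewrite wdot_self /s mulr_suml -sumrB; apply: ler_sum => i _.
    rewrite -mulrBr; apply: ler_wpM2l => //.
    apply: le_trans (Re_mulJ_near _ _); rewrite lerD2l lerN2.
    by apply: ler_pM; rewrite ?normc_ge0.
  have : r ^+ 2 * (h * (s * K')) <= r ^+ 2 * (k / 2) by rewrite ler_wpM2l ?sqr_ge0.
  nra.
exists x0; split=> // [|j].
  by apply: lt_le_trans S_ge; rewrite mulr_gt0 ?exprn_gt0//; lra.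
apply: le_trans (Re_mulJ_near _ _).
have : normc (x 0 j) * normc (x 0 j - x0 0 j) <= r * (K' * h * r).
  by apply: ler_pM; rewrite ?normc_ge0.
have : r ^+ 2 * (h * K') <= r ^+ 2 * (e * (k / 2)) by rewrite ler_wpM2l ?sqr_ge0.
have : e * (k / 2 * r ^+ 2) <= e * wdot a x x0 by rewrite ler_wpM2l// ltW.
have := sqr_ge0 (normc (x 0 j)); nra.
Qed.

End NearKernel.

(** * Self-adjoint boundary conditions *)

Section SelfAdjoint.
Context (R : realType).
Local Notation C := R[i].
Local Notation E := (symplectic_E R).
Local Notation J := (block_mx E 0 0 (- E)).

Lemma symplectic_E_sq : E *m E = - 1%:M.
Proof.
rewrite /symplectic_E (@mulmx_block C 1 1 1 1 1 1).
rewrite !(mul0mx, mulmx0, mul1mx, mulmx1, addr0, add0r).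
by rewrite (@scalar_mx_block C 1 1 1) (@opp_block_mx _ 1 1 1 1) !oppr0.
Qed.

Definition adjoint m n (A : 'M[C]_(m, n)) : 'M[C]_(n, m) := map_mx Num.conj A^T.

Lemma adjointM m n p (A : 'M[C]_(m, n)) (B : 'M[C]_(n, p)) :
  adjoint (A *m B) = adjoint B *m adjoint A.
Proof. by rewrite /adjoint trmx_mul map_mxM. Qed.

Lemma symplectic_J_sq : J *m J = - 1%:M.
Proof.
rewrite mulmx_block !(mul0mx, mulmx0, mulNmx, mulmxN, opprK, addr0, add0r).
by rewrite symplectic_E_sq (@scalar_mx_block C 2 2 1) opp_block_mx !oppr0.
Qed.

(** Self-adjointness says that the columns of J (A, B)^* solve the boundary
    condition; by the rank hypothesis they span a space of the dimension
    4 - 2 = 2 of all solutions. *)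
Lemma bc_solutions (A B : 'M[C]_2) (v : 'cV[C]_(2 + 2)) :
  self_adjoint_bc A B -> row_mx A B *m v = 0 ->
  exists c, v = J *m adjoint (row_mx A B) *m c.
Proof.
move=> [rkG sa] Gv; set G := row_mx A B in rkG Gv *.
have GJG : G *m J *m adjoint G = 0.
  rewrite /G mul_row_block !mulmx0 addr0 add0r.
  rewrite /adjoint tr_row_mx map_col_mx mul_row_col mulmxN mulNmx.
  by apply/eqP; rewrite subr_eq0; apply/eqP.
have J_unit : J \in unitmx.
  by case: (@mulmx1_unit _ _ J (- J)) => //; rewrite mulmxN symplectic_J_sq opprK.
pose H := (J *m adjoint G)^T.
have HK : (H <= kermx G^T)%MS.
  by apply/sub_kermxP; rewrite /H -trmx_mul mulmxA GJG trmx0.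
have rkH : \rank H = 2%N.
  rewrite /H trmx_mul mxrankMfree ?row_free_unit ?unitmx_tr//.
  by rewrite mxrank_tr mxrank_map mxrank_tr.
have vK : (v^T <= kermx G^T)%MS.
  by apply/sub_kermxP; rewrite -trmx_mul Gv trmx0.
have KH : (kermx G^T <= H)%MS.
  rewrite -(geq_leqif (mxrank_leqif_sup HK)).
  by rewrite mxrank_ker mxrank_tr rkG rkH.
have /submxP [D vD] := submx_trans vK KH.
by exists D^T; rewrite -[v]trmxK vD trmx_mul /H trmxK.
Qed.

Lemma symplectic_formE (Y Z : 'cV[C]_2) : (adjoint Z *m E *m Y) 0 0 =
  Y 1 0 * conjc (Z 0 0) - Y 0 0 * conjc (Z 1 0).
Proof.
pose o := ord0 : 'I_1.
have l0 : lshift 1 o = 0 :> 'I_2 by exact: val_inj.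
have r1 : rshift 1 o = 1 :> 'I_2 by exact: val_inj.
have E00 : E (lshift 1 o) (lshift 1 o) = 0
  by rewrite /symplectic_E (@block_mxEul _ 1 1 1 1) mxE.
have E01 : E (lshift 1 o) (rshift 1 o) = 1
  by rewrite /symplectic_E (@block_mxEur _ 1 1 1 1) mxE eqxx.
have E10 : E (rshift 1 o) (lshift 1 o) = -1
  by rewrite /symplectic_E (@block_mxEdl _ 1 1 1 1) !mxE eqxx.
have E11 : E (rshift 1 o) (rshift 1 o) = 0
  by rewrite /symplectic_E (@block_mxEdr _ 1 1 1 1) mxE.
rewrite ?l0 ?r1 in E00 E01 E10 E11.
have lift0 : lift ord0 ord0 = 1 :> 'I_2 by exact: val_inj.
move: E E00 E01 E10 E11 => F F00 F01 F10 F11.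
rewrite !mxE !big_ord_recl big_ord0 !mxE !big_ord_recl !big_ord0 !mxE /=.
rewrite !lift0 F00 F01 F10 F11.
rewrite -![Num.conj_op _]/(conjc _); ring.
Qed.

(** Two solutions v, z of the boundary condition satisfy z^* J v = 0: by
    [bc_solutions], J v is minus a combination of the columns of (A, B)^*, to
    which z is orthogonal.  The blocks E and - E of J contribute the two
    Wronskians. *)
Lemma self_adjoint_bc_wronskian (A B : 'M[C]_2) (Y0 YN Z0 ZN : 'cV[C]_2) :
  self_adjoint_bc A B ->
  A *m Y0 + B *m YN = 0 -> A *m Z0 + B *m ZN = 0 ->
  Y0 0 0 * conjc (Z0 1 0) - Y0 1 0 * conjc (Z0 0 0)
  = YN 0 0 * conjc (ZN 1 0) - YN 1 0 * conjc (ZN 0 0).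
Proof.
move=> sa bcY bcZ.
have [c vc] : exists c, col_mx Y0 YN = J *m adjoint (row_mx A B) *m c.
  by apply: bc_solutions sa _; rewrite mul_row_col.
have form0 : adjoint (col_mx Z0 ZN) *m J *m col_mx Y0 YN = 0.
  rewrite vc !mulmxA -(mulmxA _ J J) symplectic_J_sq mulmxN mulmx1 mulNmx.
  rewrite -adjointM mul_row_col bcZ /adjoint trmx0 map_mx0.
  by rewrite oppr0 mul0mx.
move: form0; rewrite /adjoint tr_col_mx map_row_mx mul_row_block.
rewrite !mulmx0 addr0 add0r mul_row_col mulmxN mulNmx => /eqP.
rewrite subr_eq0 => /eqP /matrixP /(_ 0 0).
by rewrite !symplectic_formE; move=> h; rewrite -[LHS]opprB h opprB.
Qed.
End SelfAdjoint.

(** * The Sturm-Liouville problem as a first-order system *)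

Section System.
Context (R : realType) (N : nat) (A B : 'M[R[i]]_2).
Local Notation C := R[i].
Local Notation normc := (@Normc.normc R).
Local Notation Re := (@complex.Re R).
Local Notation state := 'rV[C]_(N.+1 + N.+1).

Lemma Re_scale (a : R) (z : C) : Re (a%:C * z) = a * Re z.
Proof. by case: z => u v /=; rewrite mul0r subr0. Qed.

(** The coordinates 1/f_n, in which the system below is affine. *)
Definition coef_p (s : sl_eqn R N) (n : nat) : R := s.1.1 0 (inord n).
Definition potential (s : sl_eqn R N) (l : R) (k : 'I_N) : R :=
  coef_q s k - l * coef_w s k.

(** A state lists y_0, ..., y_N, then u_0, ..., u_N where u_n = f_n Delta y_n. *)
Definition sol (x : state) (n : nat) : C := x 0 (lshift N.+1 (inord n)).
Definition qder (x : state) (n : nat) : C := x 0 (rshift N.+1 (inord n)).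
Definition bvec (x : state) (n : nat) : 'cV[C]_2 :=
  \col_(i < 2) [:: sol x n; qder x n]`_i.

(** The left-hand sides of the first-order system whose solutions are the
    states of eigenfunctions.  The entry y_{N+1} is eliminated in favour of
    u_N, and with it 1/f_N. *)
Definition residual (s : sl_eqn R N) (l : R) (x : state) : 'rV[C]_(N + (N + 2)) :=
  row_mx (\row_(k < N) (sol x k.+1 - sol x k - (coef_p s k)%:C * qder x k))
    (row_mx (\row_(k < N)
               (qder x k.+1 - qder x k - (potential s l k)%:C * sol x k.+1))
       (A *m bvec x 0 + B *m bvec x N)^T).

Lemma bvec_linear n : linear (bvec^~ n).
Proof.
move=> c x z; apply/colP => i; rewrite !mxE; case: i => -[|[|//]] i /=.
  by rewrite /sol /qder !mxE.
by rewrite /sol /qder !mxE.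
Qed.

Lemma residual_linear s l : linear (residual s l).
Proof.
move=> c x z; rewrite /residual !scale_row_mx !add_row_mx; congr row_mx.
  by apply/rowP => k; rewrite /sol /qder !mxE; ring.
congr row_mx; first by apply/rowP => k; rewrite /sol /qder !mxE; ring.
rewrite !bvec_linear !mulmxDr -!scalemxAr [in RHS]linearD/= scalerDr.
rewrite -!linearZ/= -!linearD/=.
by rewrite !mulmxDr addrACA.
Qed.
HB.instance Definition _ s l :=
  GRing.isLinear.Build C _ _ _ (residual s l) (residual_linear s l).

Lemma residual_eq0 s l x : residual s l x = 0 ->
  [/\ forall k : 'I_N, sol x k.+1 = sol x k + (coef_p s k)%:C * qder x k,
      forall k : 'I_N, qder x k.+1 = qder x k + (potential s l k)%:C * sol x k.+1
    & A *m bvec x 0 + B *m bvec x N = 0].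
Proof.
rewrite /residual -!row_mx0 => /eq_row_mx [e1 /eq_row_mx [e2 e3]]; split.
- move=> k; move/rowP/(_ k): e1; rewrite !mxE => /eqP.
  by rewrite -addrA -opprD subr_eq0 => /eqP.
- move=> k; move/rowP/(_ k): e2; rewrite !mxE => /eqP.
  by rewrite -addrA -opprD subr_eq0 => /eqP.
- by apply: trmx_inj; rewrite e3 trmx0.
Qed.

Definition state_of (s : sl_eqn R N) (y : 'rV[C]_N.+2) : state :=
  row_mx (\row_n entry y n) (\row_n quasi_diff s y n).

Lemma sol_state_of s y n : (n <= N)%N -> sol (state_of s y) n = entry y n.
Proof. by move=> nN; rewrite /sol row_mxEl mxE inordK. Qed.

Lemma qder_state_of s y n : (n <= N)%N -> qder (state_of s y) n = quasi_diff s y n.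
Proof. by move=> nN; rewrite /qder row_mxEr mxE inordK. Qed.

(** The entry y_{N+1}, which the state omits, is y_N + u_N / f_N. *)
Lemma state_of_neq0 s y : Omega s -> y != 0 -> state_of s y != 0.
Proof.
move=> [invf_neq0 _]; apply: contra => /eqP x0.
have y0 n : (n <= N)%N -> entry y n = 0.
  by move=> nN; rewrite -(sol_state_of s y nN) x0 /sol mxE.
have /eqP : quasi_diff s y N = 0 by rewrite -(qder_state_of s y (leqnn N)) x0 /qder mxE.
rewrite mulf_eq0 => /orP[/eqP[] /eqP|]; first by rewrite invr_eq0 (negPf (invf_neq0 _)).
rewrite /Delta (y0 N)// subr0 => /eqP yN.
apply/eqP/rowP => n; rewrite mxE -[n]inord_val -/(entry y n).
have := ltn_ord n; rewrite ltnS leq_eqVlt => /orP[/eqP ->//|]; rewrite ltnS; exact: y0.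
Qed.

Lemma residual_state_of s l y : Omega s -> sl_solution A B s l%:C y ->
  residual s l (state_of s y) = 0.
Proof.
move=> [invf_neq0 _] [eqn bc].
have bvecE n : (n <= N)%N -> bvec (state_of s y) n = boundary_vector s y n.
  by move=> nN; apply/colP => i; rewrite !mxE sol_state_of// qder_state_of.
have e1 : \row_(k < N) (sol (state_of s y) k.+1 - sol (state_of s y) k
    - (coef_p s k)%:C * qder (state_of s y) k) = 0.
  apply/rowP => j; rewrite !mxE !sol_state_of ?qder_state_of ?(ltnW (ltn_ord j))//.
  rewrite /quasi_diff /coef_f mulrA -rmorphM/= mulfV; last exact: invf_neq0.
  by rewrite mul1r subrr.
have e2 : \row_(k < N) (qder (state_of s y) k.+1 - qder (state_of s y) k
    - (potential s l k)%:C * sol (state_of s y) k.+1) = 0.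
  apply/rowP => j; rewrite !mxE !sol_state_of ?qder_state_of ?(ltnW (ltn_ord j))//.
  have := eqn j; rewrite /= /Nabla/= => ek.
  rewrite /potential rmorphB/= rmorphM/= mulrBl -ek; ring.
by rewrite /residual e1 e2 !bvecE// bc trmx0 !row_mx0.
Qed.

Lemma inordS_lift (k : 'I_N) : inord k.+1 = lift ord0 k :> 'I_N.+1.
Proof. by apply: val_inj; rewrite /= inordK// ltnS. Qed.

(** The coefficients multiply distinct entries of the state, so the l1 norm of
    the difference of the two residuals is at most h times that of the state. *)
Lemma residual_near s l s' l' (h : R) x :
  (forall k, `|potential s' l' k - potential s l k| <= h) ->
  (forall n, `|s'.1.1 0 n - s.1.1 0 n| <= h) ->
  residual s' l' x = 0 -> l1norm (residual s l x) <= h * l1norm x.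
Proof.
move=> hr hp /residual_eq0 [e1 e2 e3].
rewrite /residual e3 !l1norm_row_mx trmx0.
have -> : l1norm (0 : 'rV[C]_2) = 0.
  by rewrite /l1norm big1// => i _; rewrite mxE Normc.normc0.
have h0 : 0 <= h by exact: le_trans (normr_ge0 _) (hp ord0).
have le1 : l1norm (\row_(k < N) (sol x k.+1 - sol x k - (coef_p s k)%:C * qder x k))
   <= h * \sum_(j < N.+1) normc (x 0 (rshift N.+1 j)).
  rewrite big_ord_recr/= mulrDr mulr_sumr /l1norm.
  rewrite -[leLHS]addr0 lerD ?mulr_ge0 ?normc_ge0//; apply: ler_sum => k _.
  rewrite mxE e1 (_ : _ - _ = (coef_p s' k - coef_p s k)%:C * qder x k); last first.
    by rewrite [in RHS]rmorphB/=; ring.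
  rewrite Normc.normcM normc_real /qder.
  rewrite (_ : inord k = widen_ord (leqnSn N) k); last first.
    by apply: val_inj; rewrite /= inordK// ltnS ltnW.
  by rewrite ler_wpM2r ?normc_ge0//; exact: hp.
have le2 : l1norm (\row_(k < N)
      (qder x k.+1 - qder x k - (potential s l k)%:C * sol x k.+1))
   <= h * \sum_(j < N.+1) normc (x 0 (lshift N.+1 j)).
  rewrite big_ord_recl/= mulrDr mulr_sumr /l1norm.
  rewrite -[leLHS]add0r lerD ?mulr_ge0 ?normc_ge0//; apply: ler_sum => k _.
  rewrite mxE e2.
  rewrite (_ : _ - _ = (potential s' l' k - potential s l k)%:C * sol x k.+1); last first.
    by rewrite [in RHS]rmorphB/=; ring.
  rewrite Normc.normcM normc_real /sol inordS_lift.
  by rewrite ler_wpM2r ?normc_ge0//; exact: hr.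
rewrite {3}/l1norm big_split_ord/=; lra.
Qed.

(** Weights for which [wdot] is the inner product, on y_1, ..., y_N, that makes
    the eigenvalue problem symmetric. *)
Definition weight (s : sl_eqn R N) (i : 'I_(N.+1 + N.+1)) : R :=
  match fintype.split i with
  | inl j => if unlift ord0 j is Some k then coef_w s k else 0
  | inr _ => 0
  end.

Lemma weight_ge0 s i : Omega s -> 0 <= weight s i.
Proof.
move=> [_ w0]; rewrite /weight; case: fintype.split => // j.
by case: unliftP => // k _; rewrite ltW.
Qed.

Lemma weight_sol s (k : 'I_N) : weight s (lshift N.+1 (inord k.+1)) = coef_w s k.
Proof. by rewrite inordS_lift /weight (unsplitK (inl _)) liftK. Qed.

Lemma wdot_weight s (x z : state) : wdot (weight s) x z =
  \sum_k coef_w s k * Re (sol x k.+1 * conjc (sol z k.+1)).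
Proof.
rewrite /wdot big_split_ord/= [X in _ + X]big1 ?addr0 => [|j _]; last first.
  by rewrite /weight (unsplitK (inr _)) mul0r.
rewrite big_ord_recl/= {1}/weight (unsplitK (inl _)) unlift_none mul0r add0r.
by apply: eq_bigr => k _; rewrite -inordS_lift weight_sol.
Qed.

(** If y_1, ..., y_N vanish, the second equation makes u constant, and that
    constant is 0 because y_2 - y_1 = p_1 u_1 with p_1 != 0; this is where
    N >= 2 is essential.  The first equation then gives y_0 = 0. *)
Lemma weight_definite s l x : (2 <= N)%N -> Omega s -> residual s l x = 0 ->
  (forall i, weight s i != 0 -> x 0 i = 0) -> x = 0.
Proof.
move=> N2 [invf_neq0 w0] /residual_eq0 [e1 e2 _] xw0.
have y0 k : (0 < k <= N)%N -> sol x k = 0.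
  case: k => // k /andP[_ kN]; apply: xw0.
  by rewrite (weight_sol s (Ordinal kN)) gt_eqF.
have u_prev k : (k < N)%N -> qder x k.+1 = qder x k.
  by move=> kN; have /= -> := e2 (Ordinal kN); rewrite y0 ?mulr0 ?addr0.
have u1 : qder x 1 = 0.
  have /= := e1 (Ordinal N2); rewrite !y0 ?(ltnW N2)// add0r => /esym /eqP.
  by rewrite mulf_eq0 => /orP[/eqP[] /eqP|/eqP//]; rewrite (negPf (invf_neq0 _)).
have u0 k : (k <= N)%N -> qder x k = 0.
  elim: k => [_|k IH kN]; last by rewrite u_prev// IH// ltnW.
  by rewrite -u_prev// (ltnW N2).
have sol0 : sol x 0 = 0.
  have N0 : (0 < N)%N by rewrite (ltnW N2).
  by have /= := e1 (Ordinal N0); rewrite y0// u0// mulr0 addr0 => ->.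
apply/rowP => m; rewrite mxE -[m]splitK; case: fintype.split => j /=.
  rewrite -[j]inord_val -/(sol x j).
  by case: (posnP j) => [->//|j0]; apply: y0; rewrite j0 -ltnS ltn_ord.
by rewrite -[j]inord_val -/(qder x j) u0// -ltnS ltn_ord.
Qed.

(** Summation by parts: the Wronskian W_n = y_n v_n^* - u_n z_n^* of the two
    states takes equal values at 0 and N, so its increments add up to 0. *)
Lemma lagrange_identity s l s' l' x z : self_adjoint_bc A B ->
  residual s' l' x = 0 -> residual s l z = 0 ->
  (l' - l) * wdot (weight s) x z =
    \sum_(k < N) (coef_q s' k - coef_q s k - l' * (coef_w s' k - coef_w s k))
       * Re (sol x k.+1 * conjc (sol z k.+1))
    - \sum_(k < N) (coef_p s' k - coef_p s k) * Re (qder x k * conjc (qder z k)).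
Proof.
move=> sa /residual_eq0 [x1 x2 xbc] /residual_eq0 [z1 z2 zbc].
pose W n := sol x n * conjc (qder z n) - qder x n * conjc (sol z n).
have W_step (k : 'I_N) : W k.+1 - W k =
   ((potential s l k - potential s' l' k)%:C * (sol x k.+1 * conjc (sol z k.+1)))
   + ((coef_p s' k - coef_p s k)%:C * (qder x k * conjc (qder z k))).
  have conjD (c d e : C) (b : R) :
      c = d + b%:C * e -> conjc c = conjc d + b%:C * conjc e.
    by move=> ->; rewrite rmorphD rmorphM; congr (_ + _ * _); exact: conjc_real.
  rewrite /W (conjD _ _ _ _ (z2 k)) (conjD _ _ _ _ (z1 k)) x2 x1.
  rewrite [X in _ = X * _ + _]rmorphB [X in _ = _ + X * _]rmorphB /=; ring.
have WN : \sum_(k < N) (W k.+1 - W k) = 0.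
  rewrite -(big_mkord xpredT (fun k => W k.+1 - W k)) telescope_sumr//.
  have := self_adjoint_bc_wronskian sa xbc zbc; rewrite !mxE/= -/(W 0) -/(W N) => ->.
  exact: subrr.
move/(congr1 Re): WN; rewrite raddf_sum/=.
under eq_bigr => k _ do rewrite W_step raddfD/= !Re_scale.
rewrite big_split/= => /eqP; rewrite addrC addr_eq0 => /eqP ->.
rewrite opprK -big_split wdot_weight mulr_sumr; apply: eq_bigr => k _ /=.
by rewrite /potential; ring.
Qed.
End System.

(** * Monotonicity from one-sided bounds on difference quotients *)

Section Dini.
Context (R : realType).

(** Clearing the denominators of the difference quotients treats both sides of
    t0 at once.  The points t between a and b with g t <= g a + e (t - a) then have b as
    their supremum: the left side of the supremum shows that it is one of them,
    the right side that it could be increased if it were below b. *)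
Lemma nonincreasing_of_slopes_le0 (I : interval R) (g : R -> R) :
  (forall t0 e, t0 \in I -> 0 < e -> \forall t \near t0, t \in I ->
     (t - t0) * (g t - g t0) <= e * (t - t0) ^+ 2) ->
  {in I &, forall a b, a <= b -> g b <= g a}.
Proof.
move=> slope a b aI bI ab.
suff upto e : 0 < e -> g b <= g a + e * (b - a).
  apply/ler_addgt0Pr => e e0.
  have ba1 : 0 < b - a + 1 by lra.
  apply: le_trans (upto (e / (b - a + 1)) (divr_gt0 e0 ba1)) _.
  rewrite lerD2l -mulrA ler_piMr ?(ltW e0)// [_^-1 * _]mulrC ler_pdivrMr//; lra.
move=> e0.
have inI t : a <= t -> t <= b -> t \in I.
  by move=> at_ tb; apply: (interval_is_interval aI bI); rewrite at_ tb.
pose A := [set t | [/\ a <= t, t <= b & g t <= g a + e * (t - a)]].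
have Aa : A a by split=> //; lra.
have hsA : has_sup A by split; [exists a | exists b => t []].
set c := sup A.
have ac : a <= c by apply: ub_le_sup => //; case: hsA.
have cb : c <= b by apply: ge_sup; [case: hsA | move=> t []].
have [/= d d0 slope_c] := (nbhs_ballP _ _).1 (slope c e (inI c ac cb) e0).
have {}slope_c t : `|c - t| < d -> a <= t -> t <= b ->
    (t - c) * (g t - g c) <= e * (t - c) ^+ 2.
  by move=> td at_ tb; apply: slope_c => //; exact: inI.
have Ac : A c.
  split=> //.
  have [t [at_ tb gt] ct] := sup_adherent d0 hsA.
  have tc : t <= c by apply: ub_le_sup; [case: hsA | split].
  have [->//|t_c] := eqVneq c t.
  have lt_tc : t < c by rewrite lt_neqAle eq_sym t_c.
  have := slope_c t; rewrite ger0_norm ?subr_ge0// => /(_ _ at_ tb) sl.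
  have {}sl : (t - c) * (g t - g c) <= e * (t - c) ^+ 2 by apply: sl; rewrite /c; lra.
  have : 0 <= (c - t) * (g t - g c + e * (c - t)) by nra.
  rewrite pmulr_rge0 ?subr_gt0// => h; nra.
have [<-|c_b] := eqVneq c b; first by case: Ac.
have lt_cb : c < b by rewrite lt_neqAle c_b.
pose t := Num.min b (c + d / 2).
have ct : c < t by rewrite /t lt_min lt_cb; lra.
have tb : t <= b by rewrite /t ge_min lexx.
have td : t <= c + d / 2 by rewrite /t ge_min lexx orbT.
have At : A t.
  split=> //; first by lra.
  have : (t - c) * (g t - g c) <= e * (t - c) ^+ 2.
    apply: slope_c => //; last by lra.
    rewrite ler0_norm; lra.
  rewrite expr2 mulrCA ler_pM2l ?subr_gt0// => sl.
  case: Ac => _ _; lra.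
have : t <= c by apply: ub_le_sup => //; case: hsA.
lra.
Qed.
End Dini.

(** * Eigenvalue branches *)

Section Branch.
Context (R : realType) (N : nat) (A B : 'M[R[i]]_2).
Variables (D : set (sl_eqn R N)) (L : sl_eqn R N -> R).
Hypotheses (N_ge2 : (2 <= N)%N) (sa : self_adjoint_bc A B).
Hypotheses (D_open : open D) (D_Omega : D `<=` @Omega R N).
Hypotheses (L_cont : {within D, continuous L}).
Hypothesis L_eigen : forall s, D s -> sl_eigenvalue A B s (L s)%:C.

Lemma coef_p_continuous (n : 'I_N.+1) : continuous (fun s : sl_eqn R N => s.1.1 0 n).
Proof.
move=> s; apply: (@continuous_comp _ _ _ (fun s : sl_eqn R N => s.1.1) (fun v => v 0 n)).
  by apply: (@continuous_comp _ _ _ (fst : sl_eqn R N -> _) fst); exact: cvg_fst.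
exact: coord_continuous.
Qed.

Lemma coef_q_continuous (k : 'I_N) : continuous (fun s : sl_eqn R N => coef_q s k).
Proof.
move=> s; apply: (@continuous_comp _ _ _ (fun s : sl_eqn R N => s.1.2) (fun v => v 0 k)).
  by apply: (@continuous_comp _ _ _ (fst : sl_eqn R N -> _) snd);
    [exact: cvg_fst|exact: cvg_snd].
exact: coord_continuous.
Qed.

Lemma coef_w_continuous (k : 'I_N) : continuous (fun s : sl_eqn R N => coef_w s k).
Proof.
move=> s; apply: (@continuous_comp _ _ _ (fun s : sl_eqn R N => s.2) (fun v => v 0 k)).
  exact: cvg_snd.
exact: coord_continuous.
Qed.

(** The first-order change of an eigenvalue, in a form that does not presuppose
    differentiability.  The numbers [a] and [b] are real parts of products of
    entries of an eigenfunction at s and of a nearby eigenfunction at s0, divided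
    by that of their weighted inner product. *)
Lemma hellmann_feynman s0 (e : R) : D s0 -> 0 < e -> \forall s \near s0,
  [/\ D s, `|L s| <= `|L s0| + 1 & exists a b : 'I_N -> R,
   [/\ forall k, - e <= a k, forall k, - e <= b k &
     L s - L s0 =
       \sum_(k < N) (coef_q s k - coef_q s0 k - L s * (coef_w s k - coef_w s0 k)) * a k
       - \sum_(k < N) (coef_p s k - coef_p s0 k) * b k]].
Proof.
move=> Ds0 e0.
have O0 := D_Omega Ds0.
have cL : L @ s0 --> L s0.
  by move: L_cont; rewrite continuous_open_subspace// => /(_ s0); apply; rewrite inE.
have [h h0 near_h] := @near_kernel R _ _ (residual A B s0 (L s0)) (weight s0)
  (fun i => weight_ge0 i O0) (fun x => weight_definite N_ge2 O0) e e0.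
near=> s.
have Ds : D s by near: s; apply: open_nbhs_nbhs; split.
have Ls : `|L s0 - L s| <= 1 by near: s; exact: cvgr_dist_le.
have dp n : `|s.1.1 0 n - s0.1.1 0 n| <= h.
  move: n; near: s; apply: filter_forall => n.
  have H : \forall u \near s0, `|s0.1.1 0 n - (u : sl_eqn R N).1.1 0 n| <= h.
    exact: (@cvgr_dist_le _ _ _ (nbhs s0) _ (fun u : sl_eqn R N => u.1.1 0 n) _
      (@coef_p_continuous n s0) h h0).
  by apply: (filterS _ H) => u; rewrite distrC.
have dr k : `|potential s (L s) k - potential s0 (L s0) k| <= h.
  move: k; near: s; apply: filter_forall => k.
  have cr : (fun s => potential s (L s) k) @ s0 --> potential s0 (L s0) k.
    apply: cvgB; first exact: coef_q_continuous.
    by apply: cvgM => //; exact: coef_w_continuous.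
  have H : \forall u \near s0, `|potential s0 (L s0) k - potential u (L u) k| <= h.
    exact: (@cvgr_dist_le _ _ _ (nbhs s0) _
      (fun u : sl_eqn R N => potential u (L u) k) _ cr h h0).
  by apply: (filterS _ H) => u; rewrite distrC.
split=> //.
  have := ler_normB (L s0) (L s0 - L s); rewrite subKr; lra.
have [y yn0 ysol] := L_eigen Ds.
have Os := D_Omega Ds.
have x_ker := residual_state_of Os ysol.
set x := state_of s y in x_ker.
have [z [z_ker S0 pos]] := near_h x (state_of_neq0 Os yn0) (residual_near dr dp x_ker).
have lag := lagrange_identity sa x_ker z_ker.
set S := wdot _ _ _ in S0 pos lag.
have divS (c d : 'I_N -> R) : \sum_k c k * (d k / S) = (\sum_k c k * d k) / S.
  by rewrite mulr_suml; apply: eq_bigr => k _; rewrite mulrA.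
exists (fun k => complex.Re (sol x k.+1 * conjc (sol z k.+1)) / S).
exists (fun k => complex.Re (qder x k * conjc (qder z k)) / S).
split=> [k|k|]; try by rewrite ler_pdivlMr// mulNr; exact: pos.
by rewrite !divS -mulrBl -lag mulfK// gt_eqF.
Unshelve. all: by end_near. Qed.

Lemma set_entryB m (v : 'rV[R]_m) (i j : 'I_m) (t t0 : R) :
  set_entry v i t 0 j - set_entry v i t0 0 j = (t - t0) * (j == i)%:R.
Proof. by rewrite !mxE; case: eqP => _; rewrite ?mulr1// mulr0 subrr. Qed.

Lemma set_entry_continuous m (v : 'rV[R]_m) (i : 'I_m) : continuous (set_entry v i).
Proof.
have -> : set_entry v i = fun t : R => set_entry v i 0 + t *: delta_mx 0 i.
  apply/funext => t; apply/rowP => j; rewrite !mxE eqxx/=.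
  by case: eqP => _; rewrite ?mulr1 ?mulr0 ?add0r ?addr0.
move=> t; apply: cvgD; first exact: cvg_cst.
by apply: cvgZr_tmp; exact: cvg_id.
Qed.

Lemma sum_only (c : 'I_N -> R) (k : 'I_N) : \sum_j (j == k)%:R * c j = c k.
Proof.
rewrite (bigD1 k)//= eqxx mul1r big1 ?addr0// => j /negPf ->; exact: mul0r.
Qed.

Lemma near_along (line : R -> sl_eqn R N) (t0 : R) (P : sl_eqn R N -> Prop) :
  continuous line -> (\forall s \near line t0, P s) -> \forall t \near t0, P (line t).
Proof. by move=> /(_ t0) c; exact: c. Qed.

Lemma pair_continuous (T U V : topologicalType) (f : T -> U) (g : T -> V) :
  continuous f -> continuous g -> continuous (fun t => (f t, g t)).
Proof. by move=> cf cg t; exact: (cvg_pair (cf t) (cg t)). Qed.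

Lemma line_invf_continuous n s : continuous (@line_invf R N n s).
Proof.
apply: pair_continuous; last by move=> t; exact: cvg_cst.
by apply: pair_continuous => t; [exact: set_entry_continuous | exact: cvg_cst].
Qed.

Lemma line_q_continuous k s : continuous (@line_q R N k s).
Proof.
apply: pair_continuous; last by move=> t; exact: cvg_cst.
by apply: pair_continuous => t; [exact: cvg_cst | exact: set_entry_continuous].
Qed.

Lemma line_w_continuous k s : continuous (@line_w R N k s).
Proof. by apply: pair_continuous => t; [exact: cvg_cst | exact: set_entry_continuous]. Qed.

(** The factor [(n < N)%N] is there because 1/f_N is absent from the system. *)
Lemma slope_coef_p (n : 'I_N.+1) s t0 (e : R) : D (line_invf n s t0) -> 0 < e ->
  \forall t \near t0, exists2 b : R, - e <= b &
    L (line_invf n s t) - L (line_invf n s t0) = - ((n < N)%N%:R * (t - t0) * b).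
Proof.
move=> D0 e0; have := hellmann_feynman D0 e0.
move/(near_along (@line_invf_continuous n s)).
apply: filterS => t [_ _ [a [b [_ b_ge ->]]]].
rewrite big1 ?sub0r => [|k _]; last by rewrite !subrr mulr0 subrr mul0r.
have coefB k : coef_p (line_invf n s t) k - coef_p (line_invf n s t0) k
    = (t - t0) * (inord k == n)%:R by rewrite /coef_p set_entryB.
under eq_bigr do rewrite coefB.
have [nN|Nn] := ltnP n N; last first.
  exists 0; first by rewrite oppr_le0 ltW.
  rewrite !mul0r big1// => k _; rewrite (_ : (inord k == n) = false) ?mulr0 ?mul0r//.
  apply/eqP => /(congr1 val); rewrite /= inordK => [kn|]; last by rewrite ltnS ltnW.
  by move: (ltn_ord k); rewrite kn ltnNge Nn.
exists (b (Ordinal nN)) => //; congr (- _).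
rewrite mul1r -(sum_only b (Ordinal nN)) mulr_sumr.
apply: eq_bigr => k _; rewrite mulrA; congr (_ * _%:R * _).
by rewrite -val_eqE /= -val_eqE /= inordK// ltnS ltnW.
Qed.

Lemma slope_q (k : 'I_N) s t0 (e : R) : D (line_q k s t0) -> 0 < e ->
  \forall t \near t0, exists2 a : R, - e <= a &
    L (line_q k s t) - L (line_q k s t0) = (t - t0) * a.
Proof.
move=> D0 e0; have := hellmann_feynman D0 e0.
move/(near_along (@line_q_continuous k s)).
apply: filterS => t [_ _ [a [b [a_ge _ ->]]]].
rewrite [X in _ - X]big1 ?subr0 => [|j _]; last by rewrite subrr mul0r.
exists (a k) => //; rewrite -(sum_only a k) mulr_sumr; apply: eq_bigr => j _.
by rewrite subrr mulr0 subr0 /coef_q set_entryB mulrA.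
Qed.

Lemma slope_w (k : 'I_N) s t0 (e : R) : D (line_w k s t0) -> 0 < e ->
  \forall t \near t0, `|L (line_w k s t)| <= `|L (line_w k s t0)| + 1 /\
    exists2 a : R, - e <= a &
    L (line_w k s t) - L (line_w k s t0) = - (L (line_w k s t) * (t - t0) * a).
Proof.
move=> D0 e0; have := hellmann_feynman D0 e0.
move/(near_along (@line_w_continuous k s)).
apply: filterS => t [_ bd [a [b [a_ge _ eL]]]].
split=> //; exists (a k) => //; rewrite {1}eL.
rewrite [X in _ - X]big1 ?subr0 => [|j _]; last by rewrite subrr mul0r.
rewrite -(sum_only a k) mulr_sumr -sumrN; apply: eq_bigr => j _.
by rewrite subrr sub0r mulNr /coef_w set_entryB !mulrA.
Qed.

Lemma decreasing_of_slopes (line : sl_eqn R N -> R -> sl_eqn R N)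
    (D' : set (sl_eqn R N)) (g : sl_eqn R N -> R) :
  (forall s t0 e, D' (line s t0) -> 0 < e -> \forall t \near t0, D' (line s t) ->
     (t - t0) * (g (line s t) - g (line s t0)) <= e * (t - t0) ^+ 2) ->
  decreasing_along line D' g.
Proof.
move=> slope s I ID.
apply: (@nonincreasing_of_slopes_le0 _ I (fun t => g (line s t))) => t0 e t0I e0.
have := slope s t0 e (ID _ t0I) e0; apply: filterS => t h tI; exact: h (ID _ tI).
Qed.

Lemma increasing_of_opp (line : sl_eqn R N -> R -> sl_eqn R N)
    (D' : set (sl_eqn R N)) (g : sl_eqn R N -> R) :
  decreasing_along line D' (fun s => - g s) -> increasing_along line D' g.
Proof.
by move=> dec s I ID t1 t2 t1I t2I le12; rewrite -lerN2; exact: (dec s I).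
Qed.

Lemma branch_decreasing_invf n : decreasing_along (line_invf n) D L.
Proof.
apply: decreasing_of_slopes => s t0 e D0 e0; have := slope_coef_p D0 e0.
apply: filterS => t [b b_ge ->] _.
case: (n < N)%N; rewrite ?mul1r ?mul0r ?oppr0 ?mulr0; last first.
  by rewrite mulr_ge0 ?sqr_ge0// ltW.
have := sqr_ge0 (t - t0); nra.
Qed.

Lemma branch_constant_invf_max : constant_along (line_invf ord_max) D L.
Proof.
have inc : increasing_along (line_invf ord_max) D L.
  apply: increasing_of_opp; apply: decreasing_of_slopes => s t0 e D0 e0.
  have := slope_coef_p D0 e0; apply: filterS => t [b b_ge eL] _.
  rewrite -opprD eL ltnn !mul0r !oppr0 mulr0 mulr_ge0 ?sqr_ge0//; exact: ltW.
have dec := @branch_decreasing_invf ord_max.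
move=> s I ID t1 t2 t1I t2I; apply/le_anti.
have [le12|/ltW le21] := leP t1 t2; apply/andP; split.
- exact: (inc s I).
- exact: (dec s I).
- exact: (dec s I).
- exact: (inc s I).
Qed.

Lemma branch_increasing_q k : increasing_along (line_q k) D L.
Proof.
apply: increasing_of_opp; apply: decreasing_of_slopes => s t0 e D0 e0.
have := slope_q D0 e0; apply: filterS => t [a a_ge eL] _.
by rewrite -opprD eL; have := sqr_ge0 (t - t0); nra.
Qed.

Lemma abs_scaled_ge (b e c a : R) : 0 < b -> 0 < e -> `|c| <= b -> - (e / b) <= a ->
  - (`|c| * a) <= e.
Proof.
move=> b0 e0 cb ab; apply: (@le_trans _ _ (`|c| * (e / b))).
  by rewrite -mulrN ler_wpM2l// lerNl.
by rewrite mulrCA ler_piMr ?(ltW e0)// ler_pdivrMr// mul1r.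
Qed.

Lemma branch_decreasing_w k : decreasing_along (line_w k) (D `&` [set s | 0 < L s]) L.
Proof.
apply: decreasing_of_slopes => s t0 e [D0 L0] e0.
have B0 : 0 < `|L (line_w k s t0)| + 1 by rewrite ltr_wpDl.
have := slope_w D0 (divr_gt0 e0 B0); apply: filterS => t [bd [a a_ge ->]] [_ /= Lt].
have := abs_scaled_ge B0 e0 bd a_ge; rewrite gtr0_norm// => La.
have := ler_wpM2r (sqr_ge0 (t - t0)) La; lra.
Qed.

Lemma branch_increasing_w k : increasing_along (line_w k) (D `&` [set s | L s < 0]) L.
Proof.
apply: increasing_of_opp; apply: decreasing_of_slopes => s t0 e [D0 L0] e0.
have B0 : 0 < `|L (line_w k s t0)| + 1 by rewrite ltr_wpDl.
have := slope_w D0 (divr_gt0 e0 B0); apply: filterS => t [bd [a a_ge eL]] [_ /= Lt].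
rewrite -opprD eL.
have := abs_scaled_ge B0 e0 bd a_ge; rewrite ltr0_norm// => La.
have := ler_wpM2r (sqr_ge0 (t - t0)) La; lra.
Qed.

End Branch.

Theorem theorem4p8 (R : realType) (N : nat) (N_ge2 : (2 <= N)%N)
    (A B : 'M[R[i]]_2) (sa : self_adjoint_bc A B)
    (D : set (sl_eqn R N)) (L : sl_eqn R N -> R)
    (branch : continuous_eigenvalue_branch A B D L) :
  [/\ forall n : 'I_N.+1, (n < N)%N -> decreasing_along (line_invf n) D L,
      constant_along (line_invf ord_max) D L,
      forall k : 'I_N, increasing_along (line_q k) D L,
      forall k : 'I_N, decreasing_along (line_w k) (D `&` [set s | 0 < L s]) L
    & forall k : 'I_N, increasing_along (line_w k) (D `&` [set s | L s < 0]) L].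
Proof.
case: branch => [[D_open _] D_Omega L_cont L_eigen _]; split.
- by move=> n _; exact: (branch_decreasing_invf N_ge2 sa).
- exact: (branch_constant_invf_max N_ge2 sa).
- by move=> k; exact: (branch_increasing_q N_ge2 sa).
- by move=> k; exact: (branch_decreasing_w N_ge2 sa).
- by move=> k; exact: (branch_increasing_w N_ge2 sa).
Qed.
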